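(* Let $d\ge 2$, $1\le i\le d-1$, $q\ge 2$ an integer and $p\in[0,1]$. Let $r$ be a box in $\mathbb{Z}^d$ and let $\xi$ be a set of $i$-plaquettes of $\mathbb{Z}^d$ (boundary conditions). Then there is a cube $\Lambda_n=[-n,n]^d$ containing $r$ such that for every box $r'\supset\Lambda_n$, $$\mu^{\xi}_{r,p,q,i}\stackrel{d}{=}\mu^{\xi_{r'}}_{r,p,q,i}\qquad\text{and}\qquad \mu^{\overline{\xi}}_{r,p,q,i}\stackrel{d}{=}\mu^{\hat{\xi}_{r'}}_{r,p,q,i},$$ where $\xi_{r'}=\xi\cap r'$ is the set of plaquettes of $\xi$ in $r'$, and $\hat{\xi}_{r'}=\xi\cup(\mathbb{Z}^d\setminus r')^{(i)}$ is the union of $\xi$ with the set of all $i$-plaquettes of $\mathbb{Z}^d$ not in $r'$.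
   Context: $\mathbb{Z}^d$ denotes the cubical complex on $\mathbb{R}^d$ whose $k$-cells are the $k$-dimensional unit cubes with integer corner points. For a subcomplex $X$, $X^{(k)}$ is the union of its cells of dimension at most $k$; $|X^{(i)}|$ denotes the number of $i$-cells ($i$-plaquettes) of $X$. An $i$-dimensional percolation subcomplex $P$ of $X$ is a subcomplex with $X^{(i-1)}\subset P\subset X^{(i)}$; $|P|$ is its number of $i$-plaquettes. Boxes: for integers $a_k<b_k$, the box $\prod_{k=1}^d[a_k,b_k]$, viewed as a complex (for the given $i$), is the union of all cells of dimension at most $i-1$ contained in it and the $i$-cells contained in it that meet its interior (the $i$-cells contained in the boundary are excluded). Measures with boundary conditions: for a finite subcomplex $X$ of $\mathbb{Z}^d$ and a set $\xi$ of $i$-plaquettes, put $P_\xi=P\cup\{\text{plaquettes of }\xi\text{ not in }X\}\cup(\mathbb{Z}^d)^{(i-1)}$ and let $\phi:P\to P_\xi$ be the inclusion. With $\phi^*:H^{i-1}(P_\xi;\mathbb{Z}_q)\to H^{i-1}(P;\mathbb{Z}_q)$, $\mathbb{Z}_q=\mathbb{Z}/q\mathbb{Z}$, the measure $\mu^{\xi}_{X,p,q,i}$ on $i$-dimensional percolation subcomplexes of $X$ is $$\mu^{\xi}_{X,p,q,i}(P)\propto p^{|P|}(1-p)^{|X^{(i)}|-|P|}\,|\mathrm{im}\,\phi^*|.$$ Borel--Moore homology $H_k^{\mathrm{BM}}(X;\mathbb{Z}_q)$ is the homology of the complex of locally finite chains: $C_k^{\mathrm{BM}}(X;\mathbb{Z}_q)$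 consists of all formal, possibly infinite, sums $\sum_\sigma a_\sigma\sigma$ over $k$-cells of $X$, with the usual boundary operator extended linearly. With $\phi_*^{\mathrm{BM}}:H_{i-1}^{\mathrm{BM}}(P;\mathbb{Z}_q)\to H_{i-1}^{\mathrm{BM}}(P_\xi;\mathbb{Z}_q)$ induced by $\phi$, $$\mu^{\overline{\xi}}_{X,p,q,i}(P)\propto p^{|P|}(1-p)^{|X^{(i)}|-|P|}\,|\mathrm{im}\,\phi_*^{\mathrm{BM}}|.$$ The symbol $\stackrel{d}{=}$ means equality of distributions. *)

(* Defs.v *)
From HB Require Import structures.
From mathcomp Require Import all_boot all_order all_algebra.
From mathcomp Require Import generic_quotient ring_quotient finmap.
From mathcomp Require Import mathcomp_extra boolp classical_sets functions.
From mathcomp Require Import cardinality fsbigop reals.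

Set Implicit Arguments.
Unset Strict Implicit.
Unset Printing Implicit Defensive.

Import Order.TTheory GRing.Theory Num.Theory.
Local Open Scope classical_set_scope.
Local Open Scope ring_scope.

Section Subquotient.
Variables (V : zmodType) (Z B : zmodClosed V).
Local Open Scope quotient_scope.

Record subgroup := SubGroup { sgval :> V; sgvalP : sgval \in Z }.

HB.instance Definition _ := [isSub for sgval].
HB.instance Definition _ := [Choice of subgroup by <:].
HB.instance Definition _ := [SubChoice_isSubZmodule of subgroup by <:].

Definition subgroup_mem : {pred subgroup} := [pred z | sgval z \in B].

Fact subgroup_mem_closed : zmod_closed subgroup_mem.
Proof.
split=> [|x y]; rewrite !inE /=; first exact: rpred0.
exact: rpredB.
Qed.

HB.instance Definition _ :=
  GRing.isZmodClosed.Build subgroup subgroup_mem subgroup_mem_closed.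

(* Z / (Z `&` B); B is not required to be contained in Z. *)
Definition subquotient := Quotient.quot subgroup_mem.
HB.instance Definition _ := GRing.Zmodule.on subquotient.

Definition class_of (z : subgroup) : subquotient := \pi z.
Definition representative (c : subquotient) : subgroup := repr c.

Lemma representativeK : cancel representative class_of.
Proof. exact: reprK. Qed.

Lemma class_of_eq z w : class_of z = class_of w <-> sgval z - sgval w \in B.
Proof.
by split=> [/eqP|zw]; [|apply/eqP]; rewrite -Quotient.idealrBE.
Qed.

End Subquotient.

Section Cells.
Variable d : nat.

(* (x, S) encodes the cube whose k-th factor is [x k, x k + 1] if k \in S, and
   the point x k otherwise. *)
Definition cell : Type := {ffun 'I_d -> int} * {set 'I_d}.
HB.instance Definition _ := Choice.on cell.

Implicit Types (s t : cell) (j : 'I_d) (b : bool).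

Definition dim s : nat := #|s.2|.

Definition translate (x : {ffun 'I_d -> int}) j (m : int) : {ffun 'I_d -> int} :=
  [ffun k => if k == j then x k + m else x k].

(* The face (b = false: back, b = true: front) of s in a direction j \in s.2,
   and the cell having t as such a face, for a direction j \notin t.2. *)
Definition face s j b : cell := (translate s.1 j b%:Z, s.2 :\ j).
Definition coface t j b : cell := (translate t.1 j (- b%:Z), j |: t.2).

(* The boundary of a cube is
     sum_(j in S) (-1)^#|{l in S, l < j}| (front face - back face).
   The sign does not depend on whether j belongs to S, so that it is the
   incidence number of (s, face s j b) and of (coface s j b, s). *)
Definition incidence (M : pzRingType) s j b : M :=
  (-1) ^+ (#|[set l in s.2 | (l < j)%N]| + ~~ b).

Record subcomplex := Subcomplex {
  cells :> set cell;
  cells_face : forall s j b, cells s -> j \in s.2 -> cells (face s j b) }.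

HB.instance Definition _ := gen_eqMixin subcomplex.
HB.instance Definition _ := gen_choiceMixin subcomplex.

Definition kcells (k : nat) (X : set cell) : set cell :=
  [set s | X s /\ dim s = k].

Definition skeleton (k : nat) (X : set cell) : set cell :=
  [set s | X s /\ (dim s <= k)%N].

Definition ncells (k : nat) (X : set cell) : nat := #|` fset_set (kcells k X)|.

Lemma dim_face s j b : j \in s.2 -> dim s = (dim (face s j b)).+1.
Proof. by move=> js; rewrite /dim /face (cardsD1 j s.2) js. Qed.

End Cells.

Arguments incidence {d M}.

Section Homology.
Variables (d q : nat).
Implicit Types (X Y : subcomplex d) (k : nat).

Local Notation chains := (cell d -> 'Z_q).

(* Arbitrary functions on the k-cells of X, extended by 0 to all cells; they
   are both the k-cochains and the locally finite k-chains of X. *)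
Definition chain k (X : set (cell d)) : set chains :=
  [set f | forall s, ~ kcells k X s -> f s = 0].

Definition coboundary (f : chains) : chains := fun s =>
  \sum_(j in s.2) \sum_(b : bool) incidence s j b * f (face s j b).

Definition boundary (a : chains) : chains := fun t =>
  \sum_(j in ~: t.2) \sum_(b : bool) incidence t j b * a (coface t j b).

Definition is_cocycle k (X : set (cell d)) : {pred chains} :=
  fun f => `[< chain k X f /\ forall s, X s -> coboundary f s = 0 >].

(* There are no cochains in degree -1. *)
Definition is_coboundary k (X : set (cell d)) : {pred chains} :=
  fun f => `[< match k with
               | 0 => f = 0
               | m.+1 => exists2 g, chain m X g &
                           patch (fun=> 0) X (coboundary g) = f
               end >].

Definition is_cycle k (X : set (cell d)) : {pred chains} :=
  fun a => `[< chain k X a /\ boundary a = 0 >].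

Definition is_boundary k (X : set (cell d)) : {pred chains} :=
  fun a => `[< exists2 c, chain k.+1 X c & boundary c = a >].

Lemma chain0 k (X : set (cell d)) : chain k X 0.
Proof. by []. Qed.

Lemma chainB k (X : set (cell d)) f g :
  chain k X f -> chain k X g -> chain k X (f - g).
Proof.
by move=> fX gX s sX; rewrite -[LHS]/(f s - g s) fX // gX // subrr.
Qed.

Lemma coboundaryB f g s :
  coboundary (f - g) s = coboundary f s - coboundary g s.
Proof.
rewrite /coboundary -sumrB; apply: eq_bigr => j _; rewrite -sumrB.
by apply: eq_bigr => b _; rewrite -mulrBr.
Qed.

Lemma coboundary0 s : coboundary 0 s = 0.
Proof. by have := coboundaryB 0 0 s; rewrite !subrr. Qed.

Lemma boundaryB a c : boundary (a - c) = boundary a - boundary c.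
Proof.
apply/funext => t; rewrite -[RHS]/(boundary a t - boundary c t).
rewrite /boundary -sumrB; apply: eq_bigr => j _; rewrite -sumrB.
by apply: eq_bigr => b _; rewrite -mulrBr.
Qed.

Lemma boundary0 : boundary 0 = 0.
Proof. by have := boundaryB 0 0; rewrite !subrr. Qed.

Lemma patchB0 (A : set (cell d)) (f g : chains) :
  patch (fun=> 0) A (f - g) = patch (fun=> 0) A f - patch (fun=> 0) A g.
Proof.
apply/funext => s; rewrite -[RHS]/(patch _ A f s - patch _ A g s) /patch.
by case: ifP => // _; rewrite subrr.
Qed.

Fact is_cocycle_closed k X : zmod_closed (is_cocycle k X).
Proof.
split=> [|f g /asboolP[fX df] /asboolP[gX dg]]; apply/asboolP; split.
- exact: chain0.
- by move=> s _; exact: coboundary0.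
- exact: chainB.
- by move=> s sX; rewrite coboundaryB df // dg // subrr.
Qed.

Fact is_coboundary_closed k X : zmod_closed (is_coboundary k X).
Proof.
case: k => [|k]; split=> [|f g].
- by apply/asboolP.
- by move=> /asboolP-> /asboolP->; apply/asboolP; rewrite subrr.
- apply/asboolP; exists 0; first exact: chain0.
  by apply/funext => s; rewrite /patch coboundary0 if_same.
- move=> /asboolP[f' f'X <-] /asboolP[g' g'X <-]; apply/asboolP.
  exists (f' - g'); first exact: chainB.
  by rewrite -patchB0; congr patch; apply/funext => s; exact: coboundaryB.
Qed.

Fact is_cycle_closed k X : zmod_closed (is_cycle k X).
Proof.
split=> [|f g /asboolP[fX df] /asboolP[gX dg]]; apply/asboolP; split.
- exact: chain0.
- exact: boundary0.
- exact: chainB.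
- by rewrite boundaryB df dg subrr.
Qed.

Fact is_boundary_closed k X : zmod_closed (is_boundary k X).
Proof.
split=> [|f g]; first by apply/asboolP; exists 0; [exact: chain0|exact: boundary0].
move=> /asboolP[f' f'X <-] /asboolP[g' g'X <-]; apply/asboolP.
by exists (f' - g'); [exact: chainB|exact: boundaryB].
Qed.

HB.instance Definition _ k X :=
  GRing.isZmodClosed.Build chains (is_cocycle k X) (is_cocycle_closed k X).
HB.instance Definition _ k X :=
  GRing.isZmodClosed.Build chains (is_coboundary k X) (is_coboundary_closed k X).
HB.instance Definition _ k X :=
  GRing.isZmodClosed.Build chains (is_cycle k X) (is_cycle_closed k X).
HB.instance Definition _ k X :=
  GRing.isZmodClosed.Build chains (is_boundary k X) (is_boundary_closed k X).

Definition cohomology k X : zmodType :=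
  subquotient (is_cocycle k X) (is_coboundary k X).

Definition BM_homology k X : zmodType :=
  subquotient (is_cycle k X) (is_boundary k X).

Section Induced.
Variables (k : nat) (X Y : subcomplex d) (XY : X `<=` Y).

Lemma restrict_cocycle f :
  f \in is_cocycle k Y -> patch (fun=> 0) X f \in is_cocycle k X.
Proof.
move=> /asboolP[fY df]; apply/asboolP; split=> [s sX|s sX].
  rewrite /patch; case: ifPn => // /set_mem Xs; apply: fY => -[_ sk].
  exact: sX.
rewrite -[RHS](df s (XY sX)); apply: eq_bigr => j js; apply: eq_bigr => b _.
by rewrite /patch mem_set //; exact: cells_face.
Qed.

Lemma include_cycle a : a \in is_cycle k X -> a \in is_cycle k Y.
Proof.
move=> /asboolP[aX da]; apply/asboolP; split=> // s sY.
by apply: aX => -[Xs sk]; apply: sY; split=> //; exact: XY.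
Qed.

(* The maps induced by the inclusion of X in Y, defined on representatives;
   cohomology_mapE and BM_homology_mapE give independence of the choice. *)
Definition cohomology_map (c : cohomology k Y) : cohomology k X :=
  class_of _ (SubGroup (restrict_cocycle (sgvalP (representative c)))).

Definition BM_homology_map (c : BM_homology k X) : BM_homology k Y :=
  class_of _ (SubGroup (include_cycle (sgvalP (representative c)))).

Lemma cohomology_mapE f (fY : f \in is_cocycle k Y) :
  cohomology_map (class_of _ (SubGroup fY)) =
  class_of _ (SubGroup (restrict_cocycle fY)).
Proof.
apply/class_of_eq; rewrite /= -patchB0.
set h := sgval _ - f; have : h \in is_coboundary k Y.
  by apply/(@class_of_eq _ _ _ _ (SubGroup fY)); exact: representativeK.
move: h => {fY} h; case: k => [|m] /asboolP.
  by move=> ->; apply/asboolP; apply/funext => s; rewrite /patch if_same.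
move=> [e eY eh]; apply/asboolP; exists (patch (fun=> 0) X e).
  move=> s sX; rewrite /patch; case: ifPn => // /set_mem Xs.
  by apply: eY => -[_ sm]; exact: sX.
rewrite -eh; apply/funext => s; rewrite /patch; case: ifPn => // /set_mem Xs.
rewrite mem_set; last exact: XY.
apply: eq_bigr => j js; apply: eq_bigr => b _.
by rewrite mem_set //; exact: cells_face.
Qed.

Lemma BM_homology_mapE a (aX : a \in is_cycle k X) :
  BM_homology_map (class_of _ (SubGroup aX)) =
  class_of _ (SubGroup (include_cycle aX)).
Proof.
apply/class_of_eq => /=.
have : sgval (representative (class_of (is_boundary k X) (SubGroup aX))) - a
    \in is_boundary k X.
  by apply/(@class_of_eq _ _ _ _ (SubGroup aX)); exact: representativeK.
move=> /asboolP[e eX ea]; apply/asboolP; exists e => // s sY.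
by apply: eX => -[Xs sk]; apply: sY; split=> //; exact: XY.
Qed.

End Induced.

End Homology.

Arguments cohomology {d} q k X.
Arguments BM_homology {d} q k X.
Arguments cohomology_map {d} q k {X Y}.
Arguments BM_homology_map {d} q k {X Y}.

Section Percolation.
Variables (d i : nat).
Implicit Types (X P : subcomplex d) (xi : set (cell d)).

Definition plaquettes : set (cell d) := kcells i setT.

Definition percolation X : set (subcomplex d) :=
  [set P | skeleton i.-1 X `<=` P /\ P `<=` skeleton i X].

Definition adjoin_set P X xi : set (cell d) :=
  P `|` ((xi `&` plaquettes) `\` X) `|` skeleton i.-1 setT.

Fact adjoin_face P X xi s j b :
  adjoin_set P X xi s -> j \in s.2 -> adjoin_set P X xi (face s j b).
Proof.
move=> + js; have sE := dim_face b js.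
case=> [[Ps|[[_ [_ si]] _]]|[_ si]].
- by left; left; exact: cells_face.
- by right; split=> //; rewrite -si sE.
- by right; split=> //; apply: leq_trans si; rewrite sE.
Qed.

(* P_xi: only the plaquettes of xi outside X are added. *)
Definition adjoin P X xi : subcomplex d :=
  Subcomplex (@adjoin_face P X xi).

Lemma sub_adjoin P X xi : P `<=` adjoin P X xi.
Proof. by move=> s Ps; left; left. Qed.

Variables (R : realType) (p : R) (q : nat).

Definition bernoulli_weight X P : R :=
  p ^+ ncells i P * (1 - p) ^+ (ncells i X - ncells i P).

(* |im phi^*| and |im phi_*^BM| for the inclusion phi of P in P_xi. Both images
   are finite when P has finitely many cells; fset_set sends infinite sets to
   fset0. *)
Definition card_im_cohomology X xi P : nat :=
  #|` fset_set (range (cohomology_map q i.-1 (@sub_adjoin P X xi)))|.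

Definition card_im_BM_homology X xi P : nat :=
  #|` fset_set (range (BM_homology_map q i.-1 (@sub_adjoin P X xi)))|.

(* The probability on the percolation subcomplexes of X proportional to w, as a
   function of events. X is meant to be finite, so that both sums range over
   finite sets. *)
Definition law X (w : subcomplex d -> R) (A : set (subcomplex d)) : R :=
  (\sum_(P \in percolation X `&` A) w P) / (\sum_(P \in percolation X) w P).

Definition prcm X xi : set (subcomplex d) -> R :=
  law X (fun P => bernoulli_weight X P * (card_im_cohomology X xi P)%:R).

Definition prcm_bar X xi : set (subcomplex d) -> R :=
  law X (fun P => bernoulli_weight X P * (card_im_BM_homology X xi P)%:R).

End Percolation.

Arguments plaquettes : clear implicits.

Section Boxes.
Variable d : nat.

Record box := Box {
  lower : 'I_d -> int;
  upper : 'I_d -> int;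
  lower_lt_upper : forall k, lower k < upper k }.

Implicit Types (r : box) (s : cell d).

Definition in_box r s : Prop :=
  forall k, lower r k <= s.1 k /\ s.1 k + (k \in s.2)%:Z <= upper r k.

(* In each coordinate, the closed interval [s.1 k, s.1 k + (k \in s.2)] meets
   the open interval ]lower r k, upper r k[. *)
Definition meets_interior r s : Prop :=
  forall k, lower r k < s.1 k + (k \in s.2)%:Z /\ s.1 k < upper r k.

Definition box_cells (i : nat) r : set (cell d) :=
  [set s | in_box r s /\
           ((dim s <= i.-1)%N \/ dim s = i /\ meets_interior r s)].

Fact box_face i r s j b :
  box_cells i r s -> j \in s.2 -> box_cells i r (face s j b).
Proof.
move=> [sr si] js; have sE := dim_face b js; split=> [k|]; last first.
  left; case: si => [si|[si _]]; last by rewrite -si sE.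
  by apply: leq_trans si; rewrite sE.
have [lo up] := sr k; rewrite /face /= ffunE !inE.
case: eqVneq lo up => [->|_] lo up /=; last by split.
rewrite js in up *; rewrite addr0; split.
  by apply: le_trans lo _; rewrite lerDl; case: (b).
by apply: le_trans up; rewrite lerD2l; case: (b).
Qed.

Definition box_complex i r : subcomplex d := Subcomplex (@box_face i r).

Definition subbox r r' : Prop :=
  forall k, lower r' k <= lower r k /\ upper r k <= upper r' k.

Fact cube_lt n : (0 < n)%N -> forall k : 'I_d, - n%:Z < n%:Z.
Proof. by move=> n0 _; rewrite gtrN // ltz_nat. Qed.

Definition cube n (n_gt0 : (0 < n)%N) : box := Box (cube_lt n_gt0).

End Boxes.

(* Main.v *)
Require Import Defs.
From mathcomp Require Import all_boot all_order all_algebra finmap.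
From mathcomp Require Import boolp classical_sets functions reals.
From mathcomp Require Import cardinality fsbigop filter zify.

Import Order.TTheory GRing.Theory Num.Theory.
Local Open Scope classical_set_scope.
Local Open Scope ring_scope.

(* Fix the box X = r.  A cochain on X extends to a cocycle of P_xi iff it
   satisfies countably many conditions, one for each plaquette of xi outside X
   and each involving finitely many cells; likewise for a locally finite
   i-chain of P_xi to fill a given cycle of P.  Only finitely many of them are
   imposed inside r' (passing from xi to xi_r' or to hat xi_r' drops the
   others).  As Z_q is finite, the solution sets are compact, so the traces on
   finitely many cells of the solutions in an exhausting sequence of cubes
   stabilize.  Hence for r' large the two images in H^(i-1)(P) are equal, and
   the same cycles of P bound in both complexes. *)

(** * Compactness for functions with values in a finite set *)

(** Otherwise [U] contains the complement of every fibre of [u], hence the finite intersection of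
    these complements, which is empty. *)
Lemma ultrafilter_finType (I : Type) (F : finType) (U : set_system I)
    (u : I -> F) :
  UltraFilter U -> exists v, U [set n | u n = v].
Proof.
move=> UU; apply: contrapT => noU.
have Uneq v : U [set n | u n <> v].
  have [Uv|//] := in_ultra_setVsetC [set n | u n = v] UU.
  by case: noU; exists v.
by have [n /(_ (u n))] := filter_ex (filter_forall _ Uneq).
Qed.

(** [g t] is the limit of [f n t] along an ultrafilter refining the eventuality filter; it contains
    all final segments, so [n] can be taken beyond [m]. *)
Lemma pointwise_cluster (T : eqType) (F : finType) (f : nat -> T -> F) :
  exists g : T -> F, forall (s : seq T) m,
    exists2 n, (m <= n)%N & {in s, f n =1 g}.
Proof.
have [U [UU subU]] := ultraFilterLemma eventually_filter.
have /choice[g gP] t := ultrafilter_finType _ _ _ (fun n => f n t) UU.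
exists g => s m.
have Us : U [set n | {in s, f n =1 g}].
  elim: s => [|t s IH]; first by apply: filterS filterT.
  apply: filterS (filterI (gP t) IH) => n [/= fgt fgs] x.
  by rewrite inE => /predU1P[->//|/fgs].
have Um : U [set n | (m <= n)%N] by apply: subU; exists m.
by have [n []] := filter_ex (filterI Us Um); exists n.
Qed.

(* The premise Kclosed says that K n is closed for pointwise convergence. *)
Lemma closed_chain_stabilizes (T : eqType) (F : finType)
    (K : nat -> set (T -> F)) (s0 : seq T) :
  (forall m n, (m <= n)%N -> K n `<=` K m) ->
  (forall n f, (forall s : seq T, exists2 g, K n g & {in s, g =1 f}) ->
    K n f) ->
  exists n, forall f, K n f ->
    exists2 g, (forall m, K m g) & {in s0, g =1 f}.
Proof.
move=> Kdecr Kclosed; apply: contrapT => nostab.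
have /choice[f fP] n : exists f, K n f /\
    ~ exists2 g, (forall m, K m g) & {in s0, g =1 f}.
  apply: contrapT => nof; apply: nostab; exists n => f Kf.
  by apply: contrapT => nog; apply: nof; exists f.
(* By monotonicity and closedness a cluster point of the [f n] lies in every [K m]; it agrees with
   some [f n] on [s0], against the choice of [f n]. *)
have [g gP] := pointwise_cluster _ _ f.
have [n _ fgn] := gP s0 0%N.
have [_] := fP n; apply; exists g => [m|t /fgn->//].
apply: Kclosed => s; have [l ml flg] := gP s m.
by exists (f l) => //; apply: Kdecr ml _ (fP l).1.
Qed.

(** * Finiteness of boxes and exhaustion by cubes *)

Section Boxes.
Variable d : nat.
Implicit Types (r : box d) (s : cell d).

Lemma box_complexS i r r' :
  subbox r r' -> box_complex i r `<=` box_complex i r'.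
Proof.
move=> rr' s [sr si]; split=> [k|].
  by have [] := rr' k; have [] := sr k; split; lia.
case: si => [?|[si sm]]; [by left|right; split=> // k].
by have [] := rr' k; have [] := sm k; split; lia.
Qed.

Lemma box_cells_seq i r : exists s : seq (cell d),
  forall t, box_cells i r t -> t \in s.
Proof.
(* A cell of the box is determined by its directions and by the offset of its corner from [lower r],
   bounded by the longest side [N]. *)
pose N := \max_k `|upper r k - lower r k|%N.
exists [seq ([ffun k => lower r k + (x.1 k)%:Z], x.2)
         | x : {ffun 'I_d -> 'I_N.+1} * {set 'I_d}].
case=> x S [xr _]; apply/fintype.imageP.
exists ([ffun k => inord `|x k - lower r k|%N], S) => //.
congr pair; apply/ffunP => k; rewrite !ffunE /= inordK.
  by have /= [] := xr k; lia.
have /= := @leq_bigmax _ (fun k => `|upper r k - lower r k|%N) k.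
by rewrite -/N; have /= [] := xr k; lia.
Qed.

Let cubeS n : box d := cube d (ltn0Sn n).

Lemma subbox_cube m n : (m <= n)%N -> subbox (cubeS m) (cubeS n).
Proof. by move=> mn k /=; split; lia. Qed.

Lemma subbox_trans r r' r'' : subbox r r' -> subbox r' r'' -> subbox r r''.
Proof. by move=> rr' rr'' k; have [] := rr' k; have [] := rr'' k; split; lia. Qed.

Lemma sub_cube r : exists n, subbox r (cubeS n).
Proof.
exists (\max_k (`|lower r k| + `|upper r k|))%N => k.
by have /= := @leq_bigmax _ (fun k => `|lower r k| + `|upper r k|)%N k; split=> /=; lia.
Qed.

Lemma cell_in_cube i s : (Defs.dim s <= i)%N -> exists n, box_cells i (cubeS n) s.
Proof.
(* The cube has half-side [N + 2], so [s] lies in its interior and is not one of the excluded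
   boundary plaquettes. *)
pose N := (\max_k `|s.1 k|)%N; move=> si; exists N.+1.
have sN k : (`|s.1 k| <= N)%N by exact: (@leq_bigmax _ (fun k => `|s.1 k|%N)).
split=> [k|]; first by have := sN k; case: (k \in _); split=> /=; lia.
move: si; rewrite leq_eqVlt => /predU1P[si|si]; [right; split=> // k|left].
  by have := sN k; case: (k \in _); split=> /=; lia.
by case: i si => [|i].
Qed.

End Boxes.

(** * Locality of the coboundary and boundary operators *)

Section Locality.
Variables (d q : nat).
Implicit Types (f g : cell d -> 'Z_q) (s t : cell d).

Definition faces s : seq (cell d) :=
  [seq face s x.1 x.2 | x : 'I_d * bool].

Definition cofaces t : seq (cell d) :=
  [seq coface t x.1 x.2 | x : 'I_d * bool].

Lemma coboundary_local f g s :
  {in faces s, f =1 g} -> coboundary f s = coboundary g s.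
Proof.
move=> fg; apply: eq_bigr => j _; apply: eq_bigr => b _; congr (_ * _).
by apply: fg; apply: (fintype.image_f (fun x => face s x.1 x.2) (x := (j, b))).
Qed.

Lemma boundary_local f g t :
  {in cofaces t, f =1 g} -> boundary f t = boundary g t.
Proof.
move=> fg; apply: eq_bigr => j _; apply: eq_bigr => b _; congr (_ * _).
by apply: fg; apply: (fintype.image_f (fun x => coface t x.1 x.2) (x := (j, b))).
Qed.

End Locality.

(** * Comparing images of induced maps *)

Lemma adjoinS d i (P X : subcomplex d) (A B : set (cell d)) :
  A `<=` B -> adjoin i P X A `<=` adjoin i P X B.
Proof.
move=> AB s [[Ps|[[As si] sX]]|sk]; [by left; left| |by right].
by left; right; split=> //; split=> //; apply: AB.
Qed.

Lemma range_cohomology_map d q k (X Y : subcomplex d) (XY : X `<=` Y) :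
  range (cohomology_map q k XY) =
  [set c | exists (f : cell d -> 'Z_q) (fY : f \in is_cocycle k Y),
    c = class_of _ (Defs.SubGroup (restrict_cocycle XY fY))].
Proof.
apply/seteqP; split=> [_ [c _ <-]|_ [f [fY ->]]].
  by exists (sgval (representative c)), (sgvalP (representative c)).
by exists (class_of _ (Defs.SubGroup fY)) => //; rewrite cohomology_mapE.
Qed.

(** The image of a class depends only on the values on [X] of a representing cocycle. *)
Lemma range_cohomology_map_sub d q k (X Y Y' : subcomplex d)
    (XY : X `<=` Y) (XY' : X `<=` Y') :
  (forall f : cell d -> 'Z_q, f \in is_cocycle k Y -> exists2 g : cell d -> 'Z_q,
     g \in is_cocycle k Y' & {in X : set _, g =1 f}) ->
  range (cohomology_map q k XY) `<=` range (cohomology_map q k XY').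
Proof.
move=> ext; rewrite !range_cohomology_map => _ [f [fY ->]].
have [g gY' gf] := ext f fY; exists g, gY'; congr class_of.
by apply: val_inj; apply/funext => s; rewrite /= /patch; case: ifP => // /gf.
Qed.

Lemma card_fset_set_inj (T U : choiceType) (f : T -> U) (A : set T) :
  {in A &, injective f} -> #|` fset_set (f @` A)| = #|` fset_set A|.
Proof.
move=> finj; have fA := inj_card_eq finj.
have [Afin|Ainf] := pselect (finite_set A).
  by apply/fcard_eq => //; exact: finite_image.
(* For infinite [A] the image is infinite too, and [fset_set] sends both to the empty set. *)
have fAinf : ~ finite_set (f @` A) by rewrite (eq_finite_set fA).
by rewrite /fset_set; case: pselect => // _; case: pselect.
Qed.

(** The map into the homology of [Y'] factors through that of [Y], and the hypothesis makes the
    second factor injective on the image of the first. *)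
Lemma card_range_BM_homology_map d q k (X Y Y' : subcomplex d)
    (XY : X `<=` Y) (YY' : Y `<=` Y') (XY' : X `<=` Y') :
  (forall a : cell d -> 'Z_q, a \in is_cycle k X ->
     a \in is_boundary k Y' -> a \in is_boundary k Y) ->
  #|` fset_set (range (BM_homology_map q k XY))| =
  #|` fset_set (range (BM_homology_map q k XY'))|.
Proof.
move=> bdY.
have BM_comp c :
    BM_homology_map q k YY' (BM_homology_map q k XY c) =
    BM_homology_map q k XY' c.
  rewrite [X in _ X]/BM_homology_map BM_homology_mapE; congr class_of.
  exact: val_inj.
have -> : range (BM_homology_map q k XY') =
    BM_homology_map q k YY' @` range (BM_homology_map q k XY).
  by rewrite image_comp; congr image; apply/funext => c /=; rewrite BM_comp.
rewrite [RHS]card_fset_set_inj // => _ _ /set_mem[c _ <-] /set_mem[e _ <-].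
rewrite !BM_comp => /class_of_eq/= ceY'; apply/class_of_eq.
by apply: bdY ceY'; apply: rpredB; exact: sgvalP.
Qed.

Lemma eq_law d (R : realType) i (X : subcomplex d) (w w' : subcomplex d -> R) :
  {in percolation i X, w =1 w'} -> law i X w = law i X w'.
Proof.
move=> ww'; apply/funext => A; rewrite /law; congr (_ / _); last exact: eq_fsbigr.
by apply: eq_fsbigr => P /set_mem[/mem_set/ww'].
Qed.

(** * Stabilization in large boxes *)

Lemma cocycle_extension_stabilizes d i q (r : box d) (xi : set (cell d)) :
  exists n, forall r', subbox (cube d (ltn0Sn n)) r' ->
    forall P : subcomplex d, P `<=` box_complex i.+1 r ->
    forall f : cell d -> 'Z_q,
      f \in is_cocycle i
        (adjoin i.+1 P (box_complex i.+1 r) (xi `&` box_complex i.+1 r')) ->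
    exists2 g : cell d -> 'Z_q,
      g \in is_cocycle i (adjoin i.+1 P (box_complex i.+1 r) xi) &
      {in P : set _, g =1 f}.
Proof.
set X := box_complex i.+1 r; pose L n := box_complex i.+1 (cube d (ltn0Sn n)).
have [s0 Xs0] := box_cells_seq d i.+1 r.
(* No condition is imposed inside [X], so the resulting [n] serves every [P]. Cochains live on
   [setT] because [adjoin] contains all i-cells. *)
pose K n : set (cell d -> 'Z_q) := [set f | chain i setT f /\
  forall s, (((xi `&` plaquettes d i.+1) `&` L n) `\` X) s ->
    coboundary f s = 0].
have [|n f fapx|n nP] := closed_chain_stabilizes _ _ K s0.
- move=> m n mn f [fc df]; split=> // s [[xis Ls] sX]; apply: df.
  by do 2![split=> //]; apply: box_complexS Ls; exact: subbox_cube.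
- split=> s sP.
    have [g [gc _] gf] := fapx [:: s].
    by rewrite -gf ?inE //; apply: gc.
  have [g [_ dg] gf] := fapx (faces d s).
  by rewrite -(coboundary_local _ _ _ _ _ gf); exact: dg.
exists n => r' nr' P PX f /asboolP[fc df].
have [|g gK gf] := nP f.
  split=> [s sk|s [[[xis si] Ls] sX]].
    by apply: fc => -[_ si]; apply: sk.
  apply: df; left; right; split=> //; split=> //; split=> //.
  by apply: box_complexS Ls.
exists g; last by move=> s /set_mem/PX/Xs0/gf.
apply/asboolP; split=> [s sk|s].
  by apply: (gK 0%N).1 => -[_ si]; apply: sk; split=> //; right; split=> //=; rewrite si.
case=> [[Ps|[[xis [sT si]] sX]]|[_ /= si]].
- rewrite -[RHS](df s); last by left; left.
  apply: eq_bigr => j js; apply: eq_bigr => b _; congr (_ * _).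
  by apply: gf; apply: Xs0; apply: PX; exact: cells_face.
- have [m Lm] := cell_in_cube d i.+1 s (eq_leq si).
  by apply: (gK m).2; split=> //; split.
(* The faces of [s] have dimension below [i], where the i-cochain [g] vanishes. *)
- apply: big1 => j js; apply: big1 => b _.
  rewrite (gK 0%N).1 ?mulr0 // => -[_ fi].
  by move: si; rewrite (dim_face b js) fi ltnn.
Qed.

Lemma boundary_filling_stabilizes d i q (r : box d) (xi : set (cell d)) :
  exists n, forall r', subbox (cube d (ltn0Sn n)) r' ->
    forall P : subcomplex d, P `<=` box_complex i.+1 r ->
    forall a : cell d -> 'Z_q, a \in is_cycle i P ->
      a \in is_boundary i (adjoin i.+1 P (box_complex i.+1 r)
              (xi `|` (plaquettes d i.+1 `\` box_complex i.+1 r'))) ->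
      a \in is_boundary i (adjoin i.+1 P (box_complex i.+1 r) xi).
Proof.
set X := box_complex i.+1 r; pose L n := box_complex i.+1 (cube d (ltn0Sn n)).
have [s0 Xs0] := box_cells_seq d i.+1 r.
(* The allowed support shrinks as [n] grows. The boundary is constrained only off [X], so [n] serves
   every [P] and every cycle [a]. *)
pose K n : set (cell d -> 'Z_q) := [set c |
  chain i.+1 (X `|` (xi `|` ~` L n)) c /\ forall t, ~ (X : set _) t -> boundary c t = 0].
(* The window contains [X], to control the support there, and the cofaces of its cells, to preserve
   the boundary on [X]. *)
have [|n f fapx|n nP] :=
  closed_chain_stabilizes _ _ K (s0 ++ flatten [seq cofaces d t | t <- s0]).
- move=> m n mn f [fc df]; split=> // s sY; apply: fc => -[[Xs|[xis|nL]] si].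
  + by apply: sY; split=> //; left.
  + by apply: sY; split=> //; right; left.
  + apply: sY; split=> //; right; right => Lm; apply: nL.
    by apply: box_complexS Lm; exact: subbox_cube.
- split=> t tP.
    have [g [gc _] gf] := fapx [:: t].
    by rewrite -gf ?inE //; apply: gc.
  have [g [_ dg] gf] := fapx (cofaces d t).
  by rewrite -(boundary_local _ _ _ _ _ gf); exact: dg.
exists n => r' nr' P PX a /asboolP[aP _] /asboolP[c cY ca].
have [|g gK gc] := nP c.
  split=> [s sX|t tX]; last by rewrite ca; apply: aP => -[/PX].
  apply: cY => -[[[Ps|[[[xis|[_ nL]] si] _]]|[_ /= si]] sE].
  + by apply: sX; split=> //; left; apply: PX.
  + by apply: sX; split=> //; right; left.
  + apply: sX; split=> //; right; right => Ls; apply: nL.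
    exact: box_complexS Ls.
  + by move: si; rewrite sE ltnn.
apply/asboolP; exists g; last first.
  apply/funext => t; have [Xt|Xt] := pselect ((X : set _) t); last first.
    by rewrite (gK 0%N).2 // aP // => -[/PX].
  rewrite -ca; apply: boundary_local => s st; apply: gc.
  rewrite mem_cat; apply/orP; right; apply/flattenP.
  by exists (cofaces d t) => //; apply: map_f; exact: Xs0.
move=> s sY; have [si|si] := eqVneq (Defs.dim s) i.+1; last first.
  by apply: (gK 0%N).1 => -[_ /eqP]; rewrite (negbTE si).
(* Inside [X], [g] equals [c], which vanishes on plaquettes outside [P] since [adjoin] adds no
   plaquette of [X]. *)
have [Xs|Xs] := pselect ((X : set _) s).
  rewrite gc ?mem_cat ?Xs0 //; apply: cY => -[[[Ps|[_ //]]|[_ /= sE]] _].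
    by apply: sY; split=> //; left; left.
  by move: sE; rewrite si ltnn.
(* Outside [X], a plaquette not in [xi] lies in some [L m], and [K m] then forces its coefficient to
   be 0. *)
have [m Lm] := cell_in_cube d i.+1 s (eq_leq si).
apply: (gK m).1 => -[[//|[xis|//]] _].
by apply: sY; split=> //; left; right.
Qed.

Theorem proposition9 (R : realType) (d i q : nat) (p : R)
    (r : box d) (xi : set (cell d)) :
  (2 <= d)%N -> (1 <= i <= d - 1)%N -> (2 <= q)%N -> 0 <= p <= 1 ->
  xi `<=` plaquettes d i ->
  exists (n : nat) (n_gt0 : (0 < n)%N),
    subbox r (cube d n_gt0) /\
    forall r' : box d, subbox (cube d n_gt0) r' ->
      prcm i p q (box_complex i r) xi =
      prcm i p q (box_complex i r) (xi `&` box_complex i r') /\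
      prcm_bar i p q (box_complex i r) xi =
      prcm_bar i p q (box_complex i r)
        (xi `|` (plaquettes d i `\` box_complex i r')).
Proof.
case: i => [//|i] _ _ _ _ _.
have [n1 n1P] := cocycle_extension_stabilizes d i q r xi.
have [n2 n2P] := boundary_filling_stabilizes d i q r xi.
have [n0 rn0] := sub_cube d r.
pose n := maxn n0 (maxn n1 n2); exists n.+1, (ltn0Sn n).
have le_cube m r' : (m <= n)%N -> subbox (cube d (ltn0Sn n)) r' ->
    subbox (cube d (ltn0Sn m)) r'.
  by move=> /(subbox_cube d) mn; exact: subbox_trans.
split=> [|r' nr'].
  by apply: subbox_trans rn0 _; apply: subbox_cube; rewrite leq_maxl.
have n1r' : subbox (cube d (ltn0Sn n1)) r'.
  by apply: le_cube nr'; rewrite !leq_max leqnn orbT.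
have n2r' : subbox (cube d (ltn0Sn n2)) r'.
  by apply: le_cube nr'; rewrite !leq_max leqnn !orbT.
have perc_sub P : P \in percolation i.+1 (box_complex i.+1 r) ->
    P `<=` box_complex i.+1 r.
  by move=> /set_mem[_ PX] s /PX[].
split; apply: eq_law => P /perc_sub PX; congr (_ * _%:R).
  rewrite /card_im_cohomology; congr (#|` fset_set _|); apply/seteqP; split.
    (* A cocycle for [xi] is itself one for the smaller complex, as both have the same i-cells; only
       the reverse inclusion uses the size of [r']. *)
    apply: range_cohomology_map_sub => f /asboolP[fc df]; exists f => //.
    have sub : adjoin i.+1 P (box_complex i.+1 r) (xi `&` box_complex i.+1 r')
        `<=` adjoin i.+1 P (box_complex i.+1 r) xi by apply: adjoinS; exact: subIsetl.
    apply/asboolP; split=> [s sk|s /sub/df//].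
    by apply: fc => -[_ si]; apply: sk; split=> //; right; split=> //=; rewrite si.
  by apply: range_cohomology_map_sub; exact: n1P.
apply: card_range_BM_homology_map; first by apply: adjoinS; exact: subsetUl.
exact: n2P.
Qed.
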